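(* Let $n\ge1$, let $\vec{2}_{2n\times 2n}$ be the configuration with two grains of sand on each non-sink vertex of the sandpile grid graph $\mathrm{S}\Gamma_{2n\times 2n}$, and let $a_n$ be the positive odd integer such that the number of domino tilings of a $2n\times 2n$ checkerboard is $2^na_n^2$. Then the order of $\vec{2}_{2n\times 2n}$ divides $a_n$.
   Context: It is a known fact that the number of domino tilings of the $2n\times2n$ checkerboard (equivalently, of perfect matchings of the $2n\times 2n$ grid graph) has the form $2^na_n^2$ with $a_n$ an odd integer, so $a_n$ is well defined. The sandpile grid graph $\mathrm{S}\Gamma_{p\times q}$ has non-sink vertices $\widetilde V=[p]\times[q]$, an edge of weight $1$ between $(a,b)$ and $(a',b')$ whenever $|a-a'|+|b-b'|=1$, and edges from grid vertices to a sink vertex $s$ with weights chosen so that every non-sink vertex has total degree $4$. Its reduced Laplacian is the $\mathbb{Z}$-linear map $\widetilde\Delta\colon\mathbb{Z}\widetilde V\to\mathbb{Z}\widetilde V$, $\widetilde\Delta(v)=4v-\sum_{w}w$, the sum over the grid neighbors $w\in\widetilde V$ of $v$. The order of a configuration $c\in\mathbb{N}\widetilde V$ is the smallest positive integer $k$ such that $k\cdot c$ (vertex-wise multiple, without stabilizing) lies in the image of $\widetilde\Delta$. *)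

(* Defs.v *)
(* Library: Mathematical Components. *)
From HB Require Import structures.
From mathcomp Require Import all_boot all_order all_algebra.

Set Implicit Arguments.
Unset Strict Implicit.
Unset Printing Implicit Defensive.

Import GRing.Theory.
Local Open Scope ring_scope.

(* Cells are indexed from 0, a translation of [p] x [q] = {1..p} x {1..q}. *)
Definition cell (p q : nat) : finType := ('I_p * 'I_q)%type.

Definition adj (p q : nat) : rel (cell p q) :=
  fun u v => (`|u.1 - v.1| + `|u.2 - v.2|)%N == 1%N.

Definition config (p q : nat) := {ffun cell p q -> nat}.

Definition zconfig (p q : nat) := {ffun cell p q -> int}.

Definition zcell (p q : nat) (v : cell p q) : zconfig p q :=
  [ffun u => (u == v)%:Z].

(* The sink edges only bring the degree of every cell up to 4: boundary cells
   also have diagonal coefficient 4 in the reduced Laplacian. *)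
Definition laplacian_gen (p q : nat) (v : cell p q) : zconfig p q :=
  zcell v *+ 4 - \sum_(w | adj v w) zcell w.

Definition laplacian (p q : nat) (f : zconfig p q) : zconfig p q :=
  \sum_v laplacian_gen v *~ f v.

Definition zconfig_of (p q : nat) (c : config p q) : zconfig p q :=
  [ffun v => (c v)%:Z].

Definition multiple_in_image (p q : nat) (c : config p q) (k : nat) : Prop :=
  exists f : zconfig p q, laplacian f = zconfig_of c *+ k.

Definition is_order (p q : nat) (c : config p q) (k : nat) : Prop :=
  [/\ (0 < k)%N, multiple_in_image c k
    & forall j : nat, (0 < j)%N -> multiple_in_image c j -> (k <= j)%N].

Definition all_twos (p q : nat) : config p q := [ffun=> 2%N].

Definition domino (p q : nat) (B : {set cell p q}) : bool :=
  [exists u, exists v, adj u v && (B == [set u; v])].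

Definition domino_tilings (p q : nat) : {set {set {set cell p q}}} :=
  [set P | partition P [set: cell p q] & [forall B in P, domino B]].

(* Main.v *)
Require Import Defs.
From HB Require Import structures.
From mathcomp Require Import all_boot all_order all_algebra.
From mathcomp Require Import fingroup perm algC.
From mathcomp Require Import mxtens ring zify.
From Stdlib Require Import Classical.

(** Let B be the n x n lower bidiagonal matrix with 1 on the diagonal and -1
    below it, and Q = B^T B.  Folding the 2n x 2n grid along its two axes turns
    the reduced Laplacian into Y |-> Q Y + Y Q, so it suffices to solve
    Q Y + Y Q = 2 a J over the integers, J being the all-ones matrix.

    Counting tilings: a suitably signed bipartite adjacency matrix K is the
    block matrix ((1 (x) B, B (x) 1), (- B^T (x) 1, 1 (x) B^T)), for which
    K K^T is block diagonal and |det K| = |det (Q (x) 1 + 1 (x) Q)|, that is,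
    the product of d_i + d_j over all pairs of eigenvalues of Q.

    Annihilation: write the characteristic polynomial of Q as
    chi = E(X^2) + X O(X^2).  Since chi(- d_i) = 2 E(d_i^2) = - 2 d_i O(d_i^2)
    and det Q = 1, the number 2^n a^2 of tilings gives a^2 as the absolute value
    of the product of the G(d_i^2) for G = E or G = O.  Choosing G monic and
    exchanging the roots of G and of chi, a^2 = r^2 with r the product of the
    values of the other polynomial at the roots of G; hence a = |r| lies in the
    ideal (E, O) of Z[X].  Modulo the image of Y |-> Q Y + Y Q, left and right
    multiplications by Q are opposite, so E(Q^2) = - Q O(Q^2) forces
    2 E(Q^2) = 2 O(Q^2) = 0 there, and 2 a annihilates the cokernel. *)

Set Implicit Arguments.
Unset Strict Implicit.
Unset Printing Implicit Defensive.

Import Order.TTheory GRing.Theory Num.Theory.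
Local Open Scope ring_scope.

(** * Rings modulo anticommutation with an element *)

Lemma poly_even_oddE (R : nzRingType) (p : {poly R}) :
  p = (even_poly p \Po 'X^2) + (odd_poly p \Po 'X^2) * 'X.
Proof.
rewrite -[LHS]coefK poly_def -sum_even_poly -sum_odd_poly.
by rewrite (bigID (fun i : 'I__ => odd i)) /= addrC.
Qed.

Section Anticommutation.

Variables (R : comNzRingType) (A : algType R) (q : A).

Definition anticomm_img (x : A) : Prop := exists y : A, q * y + y * q = x.

Lemma anticomm_imgD x y :
  anticomm_img x -> anticomm_img y -> anticomm_img (x + y).
Proof. by case=> u <- [v <-]; exists (u + v); rewrite mulrDl mulrDr addrACA. Qed.

Lemma anticomm_imgMl p x :
  GRing.comm p q -> anticomm_img x -> anticomm_img (p * x).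
Proof. by move=> pq [u <-]; exists (p * u); rewrite mulrDr !mulrA pq. Qed.

Lemma anticomm_imgN x : anticomm_img x -> anticomm_img (- x).
Proof. by case=> u <-; exists (- u); rewrite mulrN mulNr -opprD. Qed.

Lemma comm_horner_alg (p : {poly R}) (k : nat) :
  GRing.comm (horner_alg (q ^+ k) p) q.
Proof.
elim/poly_ind: p => [|p c IHp]; first by rewrite rmorph0; apply/commr_sym/commr0.
rewrite rmorphD rmorphM /= horner_algX horner_algC.
apply/commr_sym/commrD; last by rewrite /GRing.comm -scalerAr -scalerAl mulr1 mul1r.
by apply: commrM; [apply/commr_sym | apply: commrX].
Qed.

(* Modulo the image of y |-> q y + y q, multiplication by q on the left is the
   opposite of multiplication by q on the right, so q^2 becomes central. *)
Lemma anticomm_img_sqr (p : {poly R}) x :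
  anticomm_img (horner_alg (q ^+ 2) p * x - x * horner_alg (q ^+ 2) p).
Proof.
elim/poly_ind: p x => [|p c IHp] x.
  by rewrite rmorph0 mul0r mulr0 subrr; exists 0; rewrite mulr0 mul0r addr0.
rewrite rmorphD rmorphM /= horner_algX horner_algC.
set P := horner_alg _ p in IHp *.
have -> : (P * q ^+ 2 + c%:A) * x - x * (P * q ^+ 2 + c%:A)
    = P * (q ^+ 2 * x - x * q ^+ 2) + (P * (x * q ^+ 2) - (x * q ^+ 2) * P).
  have Pq2 : P * q ^+ 2 = q ^+ 2 * P by apply: commrX; apply: comm_horner_alg.
  rewrite mulrDl mulrDr -scalerAl -scalerAr mul1r mulr1 opprD addrACA subrr addr0.
  by rewrite mulrBr !mulrA addrA subrK -!mulrA Pq2 expr2 -!mulrA.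
apply: anticomm_imgD => //; apply: anticomm_imgMl; first exact: comm_horner_alg.
exists (q * x - x * q); rewrite mulrBr mulrBl !mulrA expr2.
by rewrite addrA subrK.
Qed.

Lemma anticomm_img_annihilator (chi u v : {poly R}) (r : R) (q' : A) :
    q * q' = 1 -> horner_alg q chi = 0 ->
    r%:P = u * even_poly chi + v * odd_poly chi ->
  forall x, anticomm_img ((r *: x) *+ 2).
Proof.
move=> qq' chiq0 rE.
set e := horner_alg (q ^+ 2) (even_poly chi).
set o := horner_alg (q ^+ 2) (odd_poly chi).
have hX2 p : horner_alg q (p \Po 'X^2) = horner_alg (q ^+ 2) p.
  rewrite comp_polyE; elim/poly_ind: p => [|p c IHp].
    by rewrite size_poly0 big_ord0 !rmorph0.
  rewrite -comp_polyE comp_polyD comp_polyM comp_polyX comp_polyC.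
  rewrite !rmorphD !rmorphM /= !horner_algC comp_polyE IHp horner_algX.
  by rewrite horner_algX.
have eqo : o * q = - e.
  move/eqP: chiq0; rewrite {1}[chi]poly_even_oddE rmorphD rmorphM /= !hX2.
  by rewrite horner_algX addrC addr_eq0 => /eqP.
have oq : o * q = q * o by apply: comm_horner_alg.
have I2e x : anticomm_img ((e * x) *+ 2).
  (* By [oq] and [eqo], [q * (o * x)] is [- (e * x)] and [x * q * o] is [- (x * e)]. Each of the
     three groups lies in the image, the outer two because [e] and [o] are polynomials in
     [q ^+ 2]. *)
  have -> : (e * x) *+ 2 = (e * x - x * e) - (q * (o * x) + (o * x) * q)
      + (o * (x * q) - (x * q) * o).
    have -> : x * q * o = - (x * e) by rewrite -mulrA -oq eqo mulrN.
    have -> : q * (o * x) = - (e * x) by rewrite mulrA -oq eqo mulNr.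
    rewrite !mulrA opprK; set a := e * x; set b := x * e; set c := o * x * q.
    by rewrite opprD opprK -[RHS]addrA [a - c + _]addrA subrK addrACA addNr addr0.
  apply: anticomm_imgD; last exact: anticomm_img_sqr.
  apply: anticomm_imgD; first exact: anticomm_img_sqr.
  by apply: anticomm_imgN; exists (o * x).
have I2o x : anticomm_img ((o * x) *+ 2).
  (* As [q'] inverts [q], [o * x] is [- (e * (q' * x))]. *)
  rewrite -[x]mul1r -qq' -mulrA mulrA eqo mulNr mulNrn.
  exact: anticomm_imgN.
move=> x.
have -> : r *: x = horner_alg (q ^+ 2) u * (e * x) + horner_alg (q ^+ 2) v * (o * x).
  rewrite !mulrA -mulrDl -!rmorphM -rmorphD -rE /= horner_algC.
  by rewrite -scalerAl mul1r.
rewrite mulrnDl -[(horner_alg _ u * _) *+ 2]mulrnAr -[(horner_alg _ v * _) *+ 2]mulrnAr.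
apply: anticomm_imgD; apply: anticomm_imgMl => //; exact: comm_horner_alg.
Qed.

End Anticommutation.

(** * Resultants through companion matrices *)

Lemma horner_char_poly (R : comNzRingType) n (M : 'M[R]_n) (w : R) :
  (char_poly M).[w] = \det (w%:M - M).
Proof.
rewrite /char_poly -[LHS]/(horner_eval w _) -det_map_mx; congr (\det _).
apply/matrixP=> i j; rewrite !mxE /= /horner_eval hornerD hornerN hornerC.
by rewrite hornerMn hornerX.
Qed.

Lemma prod_subr_swap (R : comNzRingType) (s : seq R) (w : R) :
  (-1) ^+ size s * \prod_(x <- s) (w - x) = \prod_(x <- s) (x - w).
Proof.
elim: s => [|x s IHs]; first by rewrite !big_nil mulr1.
by rewrite !big_cons -IHs exprS; ring.
Qed.

(** Over a closed field [p] splits, so linear factors suffice, and [\det (M - w%:M)] is up to sign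
    the characteristic polynomial at [w]. *)
Lemma det_horner_mx (F : closedFieldType) n (M : 'M[F]_n.+1) (s : seq F) p :
    char_poly M = \prod_(x <- s) ('X - x%:P) ->
  \det (horner_mx M p) = \prod_(x <- s) p.[x].
Proof.
move=> chiM.
have sz_s : size s = n.+1.
  by apply: succn_inj; rewrite -(size_prod_XsubC _ id) -chiM size_char_poly.
have det_sub w : \det (M - w%:M) = \prod_(x <- s) (x - w).
  rewrite -[M - _]opprK opprB -scaleN1r detZ -horner_char_poly chiM.
  rewrite -sz_s horner_prod -prod_subr_swap; congr (_ * _).
  by apply: eq_bigr => x _; rewrite hornerXsubC.
have [t ->] := closed_field_poly_normal p.
rewrite linearZ rmorph_prod detZ -[X in _ ^+ X]sz_s /=.
under [RHS]eq_bigr => x _ do rewrite hornerZ horner_prod.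
rewrite big_split /= big_const_seq count_predT iter_mulr_1 exchange_big /=; congr (_ * _).
elim: t => [|w t IHt]; first by rewrite !big_nil det1.
rewrite !big_cons -IHt detM; congr (_ * _).
rewrite rmorphB /= horner_mx_X horner_mx_C det_sub.
by apply: eq_bigr => x _; rewrite hornerXsubC.
Qed.

(** The integer [r] is the resultant, obtained as the determinant of [H] evaluated at the companion
    matrix of [G]; the adjugate of that matrix provides [u] and [v]. *)
Lemma prod_root_ideal (G H : {poly int}) (gs : seq algC) :
    map_poly intr G = \prod_(g <- gs) ('X - g%:P) -> G \is monic ->
  exists r : int, exists u v : {poly int},
    r%:P = u * G + v * H /\ r%:~R = \prod_(g <- gs) (map_poly intr H).[g].
Proof.
move=> GE Gmon.
have szG : size G = (size gs).+1.
  by rewrite -(size_prod_XsubC gs id) -GE size_map_poly_id0 //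
    intr_eq0 lead_coef_eq0 monic_neq0.
(* A constant monic [G] is 1; otherwise the companion matrix has positive size. *)
case: gs szG GE => [|g0 gs] /=.
  move=> /eqP szG1 _; exists 1, 1, 0.
  rewrite big_nil mul0r addr0 mul1r.
  have /size_poly1P[c c0 Gc] := szG1.
  by move: Gmon; rewrite Gc monicE lead_coefC => /eqP->.
move: (size gs) (g0 :: gs) => d {g0}{}gs szG GE.
have [C [chiC CE]] : exists C : 'M[int]_d.+1, char_poly C = G /\
    forall i j, C i j = if i == d :> nat then - G`_j else (i.+1 == j :> nat)%:R.
  have e : (size G).-1 = d.+1 by rewrite szG.
  exists (castmx (e, e) (companionmx G)); split.
    rewrite -[RHS](companionmxK Gmon); case: _ / e.
    by rewrite castmx_id.
  by move=> i j; rewrite castmxE !mxE /= {1}szG.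
(* On the column of powers of X the companion matrix acts as multiplication by X modulo [G]; only
   the last row leaves an error, namely [- G]. *)
pose V : 'cV[{poly int}]_d.+1 := \col_i 'X^i.
pose CP := map_mx polyC C.
have CV : CP *m V = 'X *: V - G *: delta_mx ord_max 0.
  apply/colP=> i; rewrite !mxE eqxx andbT.
  under eq_bigr => j _ do rewrite !mxE CE.
  case: (ltnP i d) => [lt_id|le_di].
    rewrite ltn_eqF // (_ : i == ord_max = false) ?mulr0 ?subr0; last first.
      by apply/eqP=> i_max; rewrite i_max ltnn in lt_id.
    have lt_id1 : (i.+1 < d.+1)%N by [].
    rewrite (bigD1 (Ordinal lt_id1)) //= eqxx mul1r big1 ?addr0 ?exprS // => j.
    by rewrite -val_eqE /= eq_sym => /negPf->; rewrite mul0r.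
  have /eqP i_d : i == d :> nat by rewrite eqn_leq le_di -ltnS ltn_ord.
  have -> : i = ord_max by apply: val_inj.
  rewrite !eqxx mulr1 /= -exprS.
  have {2}-> : G = 'X^(d.+1) + \sum_(j < d.+1) (G`_j)%:P * 'X^j.
    rewrite -[LHS]coefK poly_def szG big_ord_recr /= addrC; congr (_ + _).
      by move: Gmon; rewrite monicE lead_coefE szG => /eqP->; rewrite scale1r.
    by apply: eq_bigr => j _; rewrite mul_polyC.
  rewrite opprD addrA subrr add0r -sumrN; apply: eq_bigr => j _.
  by rewrite rmorphN mulNr.
have HV p : exists W, horner_mx CP (map_poly polyC p) *m V = p *: V + G *: W.
  elim/poly_ind: p => [|p c [W IHp]].
    by exists 0; rewrite !rmorph0 mul0mx scale0r scaler0 addr0.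
  exists ('X *: W - horner_mx CP (map_poly polyC p) *m delta_mx ord_max 0).
  rewrite !rmorphD !rmorphM /= map_polyX map_polyC horner_mx_X horner_mx_C /=.
  rewrite mulmxDl -mulmxA CV mulmxBr -scalemxAr IHp -scalemxAr mul_scalar_mx.
  rewrite scalerDl scalerBr !scalerDr !scalerA [_ * 'X]mulrC [G * 'X]mulrC.
  by rewrite -!addrA; congr (_ + _); rewrite addrA addrC.
have [W HVW] := HV H.
exists (\det (horner_mx C H)).
set M := horner_mx C H.
have HM : horner_mx CP (map_poly polyC H) = map_mx polyC M.
  by rewrite -[CP]/(map_mx polyC C) map_horner_mx.
exists ((map_mx polyC (\adj M) *m W) 0 0), ((map_mx polyC (\adj M) *m V) 0 0).
split.
  (* The adjugate turns [M] into its determinant; since the top entry of [V] is 1, the top row is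
     the required identity. *)
  have := congr1 (mulmx (map_mx polyC (\adj M))) HVW.
  rewrite HM mulmxA -map_mxM mul_adj_mx map_scalar_mx mul_scalar_mx mulmxDr -!scalemxAr.
  move/(congr1 (fun m : 'cV_d.+1 => m 0 0)).
  rewrite [LHS]mxE [V 0 0]mxE expr0 mulr1 => ->.
  have scale00 c (m : 'cV[{poly int}]_d.+1) : (c *: m) 0 0 = m 0 0 * c.
    by rewrite mxE mulrC.
  by rewrite mxE addrC !scale00.
rewrite -[LHS]/(intr _) -det_map_mx map_horner_mx; apply: det_horner_mx.
by rewrite -map_char_poly chiC.
Qed.

(** * The ideal generated by the even and odd parts of a polynomial *)

Lemma horner_even_odd (p : {poly int}) (x : algC) :
  (map_poly intr p).[x] = (map_poly intr (even_poly p)).[x ^+ 2]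
                        + (map_poly intr (odd_poly p)).[x ^+ 2] * x.
Proof.
rewrite {1}[p]poly_even_oddE rmorphD rmorphM /= !map_comp_poly /= map_polyXn.
by rewrite map_polyX hornerD hornerMX !horner_comp hornerXn.
Qed.

(** Each factor [d ^+ 2 - g] is the product of [sqrtC g - d] and [- sqrtC g - d]. *)
Lemma norm_prod_root_swap (G chi : {poly algC}) (gs ds : seq algC) :
    G = \prod_(g <- gs) ('X - g%:P) -> chi = \prod_(d <- ds) ('X - d%:P) ->
  `|\prod_(d <- ds) G.[d ^+ 2]|
    = `|\prod_(g <- gs) (chi.[sqrtC g] * chi.[- sqrtC g])|.
Proof.
move=> -> ->; rewrite !normr_prod.
under eq_bigr => d _ do rewrite horner_prod normr_prod.
under [RHS]eq_bigr => g _ do rewrite !horner_prod -big_split normr_prod /=.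
rewrite exchange_big /=; apply: eq_bigr => g _; apply: eq_bigr => d _.
rewrite !hornerXsubC -{1}[g]sqrtCK; congr (`|_|); ring.
Qed.

Lemma even_odd_ideal (n a : nat) (chi : {poly int}) (ds : seq algC) :
    map_poly intr chi = \prod_(d <- ds) ('X - d%:P) -> size ds = n ->
    `|\prod_(d <- ds) d| = 1 ->
    `|\prod_(x <- ds) \prod_(y <- ds) (x + y)| = (2 ^ n * a ^ 2)%:R ->
  exists u v : {poly int}, a%:Z%:P = u * even_poly chi + v * odd_poly chi.
Proof.
move=> chiE sz_ds prod1 T_E.
set E := even_poly chi; set O := odd_poly chi.
pose f (p : {poly int}) : {poly algC} := map_poly intr p.
have sz_chi : size chi = n.+1.
  by rewrite -sz_ds -(size_prod_XsubC ds id) -chiE size_map_inj_poly //; apply: intr_inj.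
have chi_n : chi`_n = 1.
  have /monicP : \prod_(d <- ds) ('X - d%:P) \is monic by apply: monic_prod_XsubC.
  rewrite -chiE lead_coefE size_map_inj_poly //; last exact: intr_inj.
  by rewrite sz_chi coef_map /= => /(@intr_inj algC _ 1).
have chi_d d : d \in ds -> (f chi).[d] = 0.
  by move=> d_ds; apply/rootP; rewrite /f chiE root_prod_XsubC.
have chiN d : (f chi).[- d] = (f E).[d ^+ 2] - (f O).[d ^+ 2] * d.
  by rewrite /f horner_even_odd sqrrN mulrN.
have T_chi : `|\prod_(d <- ds) (f chi).[- d]| = (2 ^ n * a ^ 2)%:R.
  rewrite -T_E !normr_prod; apply: eq_bigr => x _; rewrite /f chiE horner_prod.
  rewrite !normr_prod; apply: eq_bigr => y _.
  by rewrite hornerXsubC -normrN opprD !opprK.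
(* At a root [d] the two parts of [chi] cancel, so its value at [- d] is twice the even part; over
   all roots this accounts for [2 ^ n]. *)
have normE : `|\prod_(d <- ds) (f E).[d ^+ 2]| = (a ^ 2)%:R.
  have n2 : (2 ^ n)%:R != 0 :> algC by rewrite pnatr_eq0 expn_eq0.
  apply: (mulfI n2); rewrite -natrM -T_chi natrX -sz_ds -iter_mulr_1.
  rewrite -[size ds]count_predT -big_const_seq !normr_prod -big_split /=.
  rewrite !big_seq; apply: eq_bigr => d /chi_d.
  rewrite chiN /f horner_even_odd -/E -/O => /eqP; rewrite addr_eq0 => /eqP->.
  by rewrite -opprD !normrN -mulr2n normrMn mulr_natl.
have normO : `|\prod_(d <- ds) (f O).[d ^+ 2]| = (a ^ 2)%:R.
  rewrite -normE; transitivity (`|\prod_(d <- ds) (f O).[d ^+ 2]| * `|\prod_(d <- ds) d|).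
    by rewrite prod1 mulr1.
  rewrite !normr_prod -big_split /= !big_seq.
  apply: eq_bigr => d /chi_d; rewrite /f horner_even_odd -/E -/O => /eqP.
  by rewrite addr_eq0 => /eqP->; rewrite normrN normrM.
have chi_sqrt g : (f chi).[sqrtC g] * (f chi).[- sqrtC g]
    = (f E).[g] ^+ 2 - g * (f O).[g] ^+ 2.
  rewrite chiN /f horner_even_odd -/E -/O.
  by rewrite !sqrtCK -[X in _ = _ - X * _]sqrtCK; ring.
have split_monic (p : {poly int}) : p \is monic ->
    exists gs : seq algC, f p = \prod_(g <- gs) ('X - g%:P).
  move=> p_mon; have [gs fpE] := closed_field_poly_normal (f p); exists gs.
  by rewrite fpE (monicP (monic_map _ p_mon)) scale1r.
have a_of_norm (r : int) : `|r%:~R| ^+ 2 = (a ^ 2)%:R :> algC -> r = a%:Z \/ r = - a%:Z.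
  rewrite real_normK ?realz // -rmorphXn /= pmulrn => /intr_inj/eqP.
  by rewrite PoszM -expr2 eqf_sqr => /orP[]/eqP; [left | right].
have finish (G H u v : {poly int}) (r : int) : r%:P = u * G + v * H ->
   `|r%:~R| ^+ 2 = (a ^ 2)%:R :> algC -> exists u v, a%:Z%:P = u * G + v * H.
  move=> rE /a_of_norm[] r_a; first by exists u, v; rewrite -rE r_a.
  by exists (- u), (- v); rewrite !mulNr -opprD -rE r_a polyCN opprK.
(* As [chi] is monic of degree [n], its leading coefficient belongs to [O] for odd [n] and to [E]
   for even [n]; the roots of that monic part are used. *)
case: (boolP (odd n)) => n_odd.
  have O_mon : O \is monic.
    have sz_O : size O = (size chi)./2.
      by apply: size_odd_poly_eq; rewrite sz_chi /= n_odd.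
    rewrite monicE lead_coefE sz_O coef_odd_poly sz_chi.
    rewrite (_ : ((n.+1)./2).-1.*2.+1 = n) ?chi_n //.
    have [m ->] : exists m, n = m.*2.+1.
      by exists n./2; rewrite -[LHS]odd_double_half n_odd.
    by rewrite /= doubleK.
  have [gs fO] := split_monic _ O_mon.
  have [r [u [v [rE rprod]]]] := prod_root_ideal E fO O_mon.
  have [v' [u' aE]] : exists u v, a%:Z%:P = u * O + v * E.
    apply: finish rE _; rewrite rprod -normrX -prodrXl -normO.
    rewrite (norm_prod_root_swap fO chiE); congr (`|_|).
    rewrite !big_seq; apply: eq_bigr => g g_gs.
    rewrite -/(f chi) chi_sqrt.
    have /rootP -> : root (f O) g by rewrite fO root_prod_XsubC.
    by rewrite expr0n mulr0 subr0.
  by exists u', v'; rewrite addrC.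
have E_mon : E \is monic.
  have sz_E : size E = uphalf (size chi).
    by apply: size_even_poly_eq; rewrite sz_chi /= n_odd.
  rewrite monicE lead_coefE sz_E coef_even_poly sz_chi /=.
  by rewrite -[X in chi`_X](_ : n = _) ?chi_n // -[LHS]odd_double_half (negPf n_odd).
have [gs fE] := split_monic _ E_mon.
have [r [u [v [rE rprod]]]] := prod_root_ideal O fE E_mon.
(* At a root [g] of [E], [chi_sqrt] leaves [- g] times the square of [O] at [g]. The extra factors
   multiply, up to sign, to the common constant term of [E] and [chi], of absolute value 1. *)
have E0 : `|\prod_(g <- gs) g| = 1.
  have : `|(f E).[0]| = `|(f chi).[0]|.
    by rewrite /f [in RHS]horner_even_odd mulr0 addr0 expr0n.
  rewrite fE {1}/f chiE !horner_prod.
  have normN (s : seq algC) : `|\prod_(x <- s) ('X - x%:P).[0]| = `|\prod_(x <- s) x|.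
    by rewrite !normr_prod; apply: eq_bigr => x _; rewrite hornerXsubC sub0r normrN.
  by rewrite !normN prod1.
apply: finish rE _.
rewrite rprod -normrX -prodrXl -normE (norm_prod_root_swap fE chiE).
transitivity (`|\prod_(g <- gs) g| * `|\prod_(g <- gs) (f O).[g] ^+ 2|).
  by rewrite E0 mul1r.
rewrite !normr_prod -big_split /= !big_seq; apply: eq_bigr => g g_gs.
rewrite -/(f chi) chi_sqrt.
have /rootP -> : root (f E) g by rewrite fE root_prod_XsubC.
by rewrite expr0n sub0r normrN [RHS]normrM.
Qed.

(** * Tensor sums and the double matrix *)

Local Notation "A *t B" := (tensmx A B)
  (at level 40, left associativity, format "A  *t  B") : ring_scope.

Lemma tensmx1 (R : pzRingType) m n : (1%:M : 'M[R]_m) *t (1%:M : 'M_n) = 1%:M.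
Proof.
apply/matrixP=> k l; case: (mxtens_indexP k) => i j; case: (mxtens_indexP l) => i' j'.
rewrite tensmxE !mxE (can_eq (@mxtens_indexK m n)) xpair_eqE.
by case: eqP => _; case: eqP => _; rewrite /= !(mulr1n, mulr0n, mulr1, mulr0).
Qed.

Lemma char_poly_similar (R : comNzRingType) n (P P' A : 'M[R]_n) :
  P' *m P = 1%:M -> char_poly (P' *m A *m P) = char_poly A.
Proof.
move=> P'P; rewrite /char_poly.
have -> : char_poly_mx (P' *m A *m P)
    = map_mx polyC P' *m char_poly_mx A *m map_mx polyC P.
  rewrite /char_poly_mx mulmxBr mulmxBl !map_mxM; congr (_ - _).
  by rewrite scalar_mxC -mulmxA -map_mxM P'P map_mx1 mulmx1.
by rewrite !det_mulmx mulrAC -det_mulmx -map_mxM P'P map_mx1 det1 mul1r.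
Qed.

(* Sylvester operator X |-> A X + X A^T, as a matrix on the tensor square. *)
Definition kron_sum (R : pzRingType) n (A : 'M[R]_n) : 'M[R]_(n * n) :=
  A *t 1%:M + 1%:M *t A.

Lemma kron_sum_diag (R : comNzRingType) n (d : 'rV[R]_n) :
  \det (kron_sum (diag_mx d)) = \prod_i \prod_j (d 0 i + d 0 j).
Proof.
have -> : kron_sum (diag_mx d) = diag_mx (\row_k
    (d 0 (mxtens_unindex k).1 + d 0 (mxtens_unindex k).2)).
  apply/matrixP=> k l; case: (mxtens_indexP k) => i j.
  case: (mxtens_indexP l) => i' j'; rewrite mxE !tensmxE !mxE.
  rewrite (can_eq (@mxtens_indexK n n)) mxtens_indexK xpair_eqE /=.
  by case: eqP => _; case: eqP => _;
     rewrite /= !(mulr1n, mulr0n, mulr1, mul1r, mulr0, mul0r, addr0).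
rewrite det_diag pair_bigA.
rewrite (reindex (@mxtens_index n n)); last first.
  by exists (@mxtens_unindex n n) => k _; rewrite (mxtens_indexK, mxtens_unindexK).
by apply: eq_bigr => -[i j] _; rewrite mxE mxtens_indexK.
Qed.

Lemma kron_sum_similar (R : comNzRingType) n (P P' A : 'M[R]_n) :
  P' *m P = 1%:M -> \det (kron_sum (P' *m A *m P)) = \det (kron_sum A).
Proof.
move=> P'P; have -> : kron_sum (P' *m A *m P) = (P' *t P') *m kron_sum A *m (P *t P).
  rewrite /kron_sum mulmxDr mulmxDl !tensmx_mul !mulmx1.
  by rewrite P'P.
by rewrite !det_mulmx mulrAC -det_mulmx tensmx_mul P'P tensmx1 det1 mul1r.
Qed.

(** A real symmetric matrix is normal, hence diagonalizable over [algC]; the same change of basis,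
    tensored with itself, diagonalizes the tensor sum. *)
Lemma sym_int_spectrum n (A : 'M[int]_n) : A^T = A ->
  exists2 ds : seq algC, size ds = n
    & map_poly intr (char_poly A) = \prod_(d <- ds) ('X - d%:P) /\
      (\det (kron_sum A))%:~R = \prod_(x <- ds) \prod_(y <- ds) (x + y).
Proof.
move=> symA; pose AC : 'M[algC]_n := map_mx intr A.
have normA : AC \is normalmx.
  apply/normalmxP; rewrite (_ : (AC ^t*)%sesqui = AC) //.
  apply/matrixP=> i j; rewrite !mxE -[in RHS]symA mxE.
  by apply/CrealP/realz.
have /orthomx_spectralP := normA.
set P := spectralmx AC; set d := spectral_diag AC => AE.
have PP : invmx P *m P = 1%:M by rewrite mulVmx // spectral_unit.
exists [seq d 0 i | i <- index_enum 'I_n].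
  by rewrite size_map -[RHS](size_enum_ord n) enumT.
rewrite !big_map; split.
  rewrite map_char_poly /= -/AC AE char_poly_similar // char_poly_trig; last first.
    by apply: diag_mx_is_trig.
  by apply: eq_bigr => i _; rewrite !mxE eqxx.
rewrite -[LHS]/(intr _) -det_map_mx.
have -> : map_mx intr (kron_sum A) = kron_sum AC.
  by rewrite /kron_sum map_mxD !map_mxT !map_mx1.
rewrite AE kron_sum_similar // kron_sum_diag; apply: eq_bigr => i _.
by rewrite big_map.
Qed.

(* Kasteleyn-type block matrix: the rows stand for the (even, even) and
   (odd, odd) cells, the columns for the (even, odd) and (odd, even) ones. *)
Definition double_mx (n : nat) (B : 'M[int]_n) : 'M[int]_(n * n + n * n) :=
  block_mx (1%:M *t B) (B *t 1%:M) (- (B^T *t 1%:M)) (1%:M *t B^T).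

(** Multiplying by the transpose gives diagonal blocks built from [B *m B^T] and [B^T *m B]. These
    are conjugate by [B], so the squares of both sides agree. *)
Lemma det_double_mx n (B : 'M[int]_n) : \det B = 1 ->
  `|\det (double_mx B)| = `|\det (kron_sum (B^T *m B))|.
Proof.
move=> detB.
have KK : double_mx B *m (double_mx B)^T
    = block_mx (kron_sum (B *m B^T)) 0 0 (kron_sum (B^T *m B)).
  rewrite /double_mx tr_block_mx mulmx_block !linearN /= !trmx_tens !trmxK !trmx1.
  rewrite !mulNmx opprK !tensmx_mul !mul1mx !mulmx1 /kron_sum.
  by congr block_mx; rewrite ?addNr // addrC.
have kronE : \det (kron_sum (B *m B^T)) = \det (kron_sum (B^T *m B)).
  have BB : B *m \adj B = 1%:M by rewrite mul_mx_adj detB.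
  have -> : B *m B^T = B *m (B^T *m B) *m \adj B by rewrite -!mulmxA BB mulmx1.
  by rewrite kron_sum_similar.
have := congr1 determinant KK.
rewrite det_mulmx det_tr det_ublock kronE => /eqP; rewrite -!expr2 eqf_sqr.
by case/orP=> /eqP ->; rewrite ?normrN.
Qed.

Lemma sylvester_solvable n a (B : 'M[int]_n.+1) :
    \det B = 1 -> `|\det (double_mx B)| = (2 ^ n.+1 * a ^ 2)%:R ->
  forall Z : 'M[int]_n.+1, exists Y,
    (B^T *m B) *m Y + Y *m (B^T *m B) = Z *+ (2 * a).
Proof.
move=> detB; rewrite det_double_mx //; set Q := B^T *m B => detE Z.
have symQ : Q^T = Q by rewrite trmx_mul trmxK.
have detQ : \det Q = 1 by rewrite det_mulmx det_tr detB.
have [ds sz_ds [chiE kronE]] := sym_int_spectrum symQ.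
have prod1 : `|\prod_(d <- ds) d| = 1.
  have /(congr1 (fun p : {poly algC} => `|p.[0]|)) := chiE.
  rewrite horner_prod normr_prod horner_coef0 coef_map /= char_poly_det detQ mulr1.
  rewrite rmorphXn rmorphN1 normrX normrN1 expr1n => e; apply: etrans (esym e).
  by rewrite normr_prod; apply: eq_bigr => d _; rewrite hornerXsubC sub0r normrN.
have T_E : `|\prod_(x <- ds) \prod_(y <- ds) (x + y)| = (2 ^ n.+1 * a ^ 2)%:R.
  by rewrite -kronE -intr_norm detE rmorph_nat.
have [u [v aE]] := even_odd_ideal chiE sz_ds prod1 T_E.
have QV : Q * \adj Q = 1 by rewrite -[LHS]/(Q *m _) mul_mx_adj detQ.
have chiQ : horner_alg Q (char_poly Q) = 0.
  by have := poly_alg_initial (horner_mx Q) (char_poly Q);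
    rewrite /= horner_mx_X Cayley_Hamilton => <-.
have [Y YE] := anticomm_img_annihilator QV chiQ aE Z.
exists Y; rewrite -[LHS]/(Q * Y + Y * Q) YE mulnC mulrnA; congr (_ *+ _).
by rewrite -scaler_nat natz.
Qed.

(** * Folding the grid Laplacian *)

Lemma adjC p q : symmetric (@adj p q).
Proof. by move=> u v; rewrite /adj (distnC u.1) (distnC u.2). Qed.

Lemma laplacianE p q (f : zconfig p q) (u : cell p q) :
  laplacian f u = f u *+ 4 - \sum_(w | adj u w) f w.
Proof.
have genE v : laplacian_gen v u = (u == v)%:R *+ 4 - (adj v u)%:R.
  rewrite /laplacian_gen !ffunE; congr (_ - _).
    by case: eqP.
  rewrite [LHS]sum_ffunE big_mkcond /= (bigD1 u) //= big1 ?addr0 => [|w].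
    by rewrite ffunE eqxx; case: (adj v u).
  by rewrite ffunE eq_sym => /negPf ->; case: ifP.
rewrite /laplacian sum_ffunE.
transitivity (\sum_v ((u == v)%:R * f v *+ 4 - (adj u v)%:R * f v)).
  apply: eq_bigr => v _; rewrite ffunMzE genE -mulrzr intz mulrBl -mulrnAl.
  by rewrite adjC.
rewrite sumrB; congr (_ - _).
  rewrite (bigD1 u) //= eqxx mul1r big1 ?addr0 // => v.
  by rewrite eq_sym => /negPf ->; rewrite mul0r mul0rn.
rewrite [RHS]big_mkcond; apply: eq_bigr => v _.
by case: (adj u v); rewrite ?mul1r ?mul0r.
Qed.

Lemma sum_adj p q (f : zconfig p q) (u : cell p q) :
  \sum_(w | adj u w) f w
    = \sum_(i : 'I_p | `|u.1 - i|%N == 1%N) f (i, u.2)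
    + \sum_(j : 'I_q | `|u.2 - j|%N == 1%N) f (u.1, j).
Proof.
rewrite [LHS]big_mkcond [X in X + _]big_mkcond [X in _ + X]big_mkcond /=.
transitivity (\sum_i \sum_j (if adj u (i, j) then f (i, j) else 0)).
  by rewrite pair_bigA /=; apply: eq_bigr => -[i j].
transitivity (\sum_(i : 'I_p) \sum_(j : 'I_q)
   ((if (`|u.1 - i|%N == 1%N) && (j == u.2) then f (i, j) else 0)
  + (if (i == u.1) && (`|u.2 - j|%N == 1%N) then f (i, j) else 0))).
  apply: eq_bigr => i _; apply: eq_bigr => j _.
  have -> : adj u (i, j) = (`|u.1 - i|%N == 1%N) && (j == u.2)
      || (i == u.1) && (`|u.2 - j|%N == 1%N).
    by rewrite /adj /= -!val_eqE /=; lia.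
  case: (eqVneq i u.1) => [->|_]; case: (eqVneq j u.2) => [->|_];
    by rewrite ?distnn ?andbT ?andbF /= ?orbF ?addr0 ?add0r //;
    case: ifP; rewrite ?addr0 ?add0r.
under [LHS]eq_bigr => i _ do rewrite big_split.
rewrite big_split /=; congr (_ + _).
  apply: eq_bigr => i _; rewrite (bigD1 u.2) //= eqxx andbT big1 ?addr0 //.
  by move=> j /negPf ->; rewrite andbF.
rewrite (bigD1 u.1) //= eqxx [X in _ + X]big1 ?addr0 //.
by move=> i /negPf ->; rewrite big1.
Qed.

Lemma sum_dist1 N (F : nat -> int) (i : 'I_N) :
  \sum_(k < N | `|i - k|%N == 1%N) F k
    = (if (0 < i)%N then F i.-1 else 0) + (if (i.+1 < N)%N then F i.+1 else 0).
Proof.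
transitivity (\sum_(k < N) ((if (k.+1 == i :> nat) then F k else 0)
                          + (if (k == i.+1 :> nat) then F k else 0))).
  rewrite big_mkcond; apply: eq_bigr => k _.
  have -> : (`|i - k|%N == 1%N) = (k.+1 == i :> nat) || (k == i.+1 :> nat) by lia.
  case: (eqVneq k.+1 i) => [ki|]; last by rewrite add0r.
  by rewrite ifF ?addr0 //; lia.
rewrite big_split /=; congr (_ + _).
  case: ifP => [i_gt0|/negbT i_le0].
    have i1 : (i.-1 < N)%N by have := ltn_ord i; lia.
    rewrite (bigD1 (Ordinal i1)) //= prednK // eqxx big1 ?addr0 // => k.
    by rewrite -val_eqE /= => ki; rewrite ifF //; lia.
  by rewrite big1 // => k _; rewrite ifF //; lia.
case: ifP => [i1|/negbT i1].
  rewrite (bigD1 (Ordinal i1)) //= eqxx big1 ?addr0 // => k.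
  by rewrite -val_eqE /= => /negPf ->.
by rewrite big1 // => k _; rewrite ifF //; have := ltn_ord k; lia.
Qed.

Definition bidiag (n : nat) : 'M[int]_n :=
  \matrix_(i, j) ((i == j)%:R - (i == j.+1 :> nat)%:R).

Lemma det_bidiag n : \det (bidiag n) = 1.
Proof.
rewrite det_trig.
  by rewrite big1 // => i _; rewrite !mxE eqxx ltn_eqF // subr0.
apply/is_trig_mxP => i j ij; rewrite !mxE -val_eqE /= !ltn_eqF ?subr0 //.
exact: ltnW.
Qed.

(** [bidiag n] is the backward difference with value 0 before the first vertex. Its Gram matrix is
    thus a path Laplacian, absorbing before 0 and reflecting after [n.-1], where [F i] replaces the
    missing neighbour. *)
Lemma gram_bidiag n (F : nat -> int) (i : 'I_n) :
  \sum_k ((bidiag n)^T *m bidiag n) i k * F k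
    = F i *+ 2 - ((if (0 < i)%N then F i.-1 else 0)
                + (if (i.+1 < n)%N then F i.+1 else F i)).
Proof.
pose v : 'cV[int]_n := \col_k F k.
have -> : \sum_k ((bidiag n)^T *m bidiag n) i k * F k
    = ((bidiag n)^T *m (bidiag n *m v)) i 0.
  by rewrite mulmxA mxE; apply: eq_bigr => k _; rewrite [v _ _]mxE.
have Bv j : (bidiag n *m v) j 0 = F j - (if (0 < j)%N then F j.-1 else 0).
  rewrite mxE.
  under eq_bigr => k _ do rewrite !mxE mulrBl.
  rewrite sumrB; congr (_ - _).
    rewrite (bigD1 j) //= eqxx mul1r big1 ?addr0 // => k.
    by rewrite eq_sym => /negPf ->; rewrite mul0r.
  case: ifP => [j_gt0|/negbT j_le0].
    have j1 : (j.-1 < n)%N by have := ltn_ord j; lia.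
    rewrite (bigD1 (Ordinal j1)) //= prednK // eqxx mul1r big1 ?addr0 // => k.
    by rewrite -val_eqE /= => kj; rewrite (_ : (_ == _) = false) ?mul0r //; lia.
  by rewrite big1 // => k _; rewrite (_ : (_ == _) = false) ?mul0r //; lia.
rewrite mxE.
under eq_bigr => k _ do rewrite mxE mxE mulrBl.
rewrite sumrB (bigD1 i) //= eqxx mul1r big1 ?addr0 => [|k /negPf ->];
  last by rewrite mul0r.
rewrite Bv.
case: ifP => i_gt0; case: ifP => [i1|/negbT i1].
1,3: rewrite (bigD1 (Ordinal i1)) //= eqxx mul1r big1 ?addr0;
  [rewrite Bv /=; ring | by move=> k; rewrite -val_eqE /= => /negPf ->; rewrite mul0r].
all: rewrite big1; [ring | move=> k _].
all: by rewrite (_ : (_ == _) = false) ?mul0r //; have := ltn_ord k; lia.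
Qed.

(** The central indices [n.-1] and [n] both fold to [n.-1], which creates the reflecting end; the
    outer ones fold to 0, the absorbing end. *)
Definition fold_nat (n i : nat) : nat := if (i < n)%N then i else ((2 * n).-1 - i)%N.

Lemma fold_nat_lt n (i : 'I_(2 * n)) : (fold_nat n i < n)%N.
Proof. by rewrite /fold_nat; have := ltn_ord i; case: (ltnP i n) => ? ?; lia. Qed.

Definition fold_ord n (i : 'I_(2 * n)) : 'I_n := Ordinal (fold_nat_lt i).

(* The reflection of the doubled path turns its Dirichlet Laplacian into the
   Gram matrix of the bidiagonal matrix. *)
Lemma gram_bidiag_fold n (F : nat -> int) (i : 'I_(2 * n)) :
  \sum_k ((bidiag n)^T *m bidiag n) (fold_ord i) k * F k
    = F (fold_ord i) *+ 2
    - \sum_(k : 'I_(2 * n) | `|i - k|%N == 1%N) F (fold_nat n k).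
Proof.
rewrite gram_bidiag (sum_dist1 (fun k => F (fold_nat n k))); congr (_ - _) => /=.
have := ltn_ord i; move: (nat_of_ord i) => {}i i_lt; rewrite /fold_nat.
case: (ltnP i n) => [i_n|n_i].
  congr (_ + _).
    by case: ifP => // i0; rewrite ifT //; lia.
  rewrite (_ : (i.+1 < 2 * n)%N); last by lia.
  case: ifP => // /negbT i1; congr F; lia.
rewrite addrC; congr (_ + _).
  rewrite (_ : (0 < i)%N); last by lia.
  case: ifP => [i1|/negbT i1]; case: ifP => i2; congr F; lia.
rewrite (_ : (0 < (2 * n).-1 - i)%N = (i.+1 < 2 * n)%N); last by lia.
case: ifP => // i1; rewrite ifF; [congr F|]; lia.
Qed.

Definition unfold_config n (Y : 'M[int]_n) : zconfig (2 * n) (2 * n) :=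
  [ffun u => Y (fold_ord u.1) (fold_ord u.2)].

Lemma laplacian_unfold n (Y : 'M[int]_n) (u : cell (2 * n) (2 * n)) :
  let Q := (bidiag n)^T *m bidiag n in
  laplacian (unfold_config Y) u
    = (Q *m Y + Y *m Q) (fold_ord u.1) (fold_ord u.2).
Proof.
move=> Q; rewrite laplacianE sum_adj mxE.
case: u => i j /=; rewrite !ffunE /=.
under eq_bigr => k _ do rewrite ffunE /=.
under [X in _ - (_ + X)]eq_bigr => k _ do rewrite ffunE /=.
(* Extension by 0, as the folding lemma takes functions on [nat]. *)
pose ext (g : 'I_n -> int) (k : nat) := oapp g 0 (insub k).
have extE g (k : 'I_n) : ext g k = g k by rewrite /ext valK.
have extF g (k : 'I_(2 * n)) : ext g (fold_nat n k) = g (fold_ord k).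
  by rewrite -(extE g (fold_ord k)).
have rowE : (Q *m Y) (fold_ord i) (fold_ord j) = Y (fold_ord i) (fold_ord j) *+ 2
    - \sum_(k : 'I_(2 * n) | `|i - k|%N == 1%N) Y (fold_ord k) (fold_ord j).
  pose g := ext (fun k => Y k (fold_ord j)).
  rewrite (eq_bigr (fun k : 'I_(2 * n) => g (fold_nat n k))) => [|k _];
    last by rewrite /g extF.
  rewrite -[Y _ _](extE (fun k => Y k (fold_ord j))) -gram_bidiag_fold mxE.
  by apply: eq_bigr => k _; rewrite extE.
have symQ : Q^T = Q by rewrite trmx_mul trmxK.
have colE : (Y *m Q) (fold_ord i) (fold_ord j) = Y (fold_ord i) (fold_ord j) *+ 2
    - \sum_(k : 'I_(2 * n) | `|j - k|%N == 1%N) Y (fold_ord i) (fold_ord k).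
  pose g := ext (Y (fold_ord i)).
  rewrite (eq_bigr (fun k : 'I_(2 * n) => g (fold_nat n k))) => [|k _];
    last by rewrite /g extF.
  rewrite -[Y _ _](extE (Y (fold_ord i))) -gram_bidiag_fold mxE.
  by apply: eq_bigr => k _; rewrite extE mulrC -/Q -[in LHS]symQ [in LHS]mxE.
rewrite rowE colE; ring.
Qed.

(** The image is closed under subtraction, so a nonzero remainder of [a] modulo the least multiple
    would be a smaller one. *)
Lemma is_order_dvdn p q (c : config p q) a : (0 < a)%N ->
  multiple_in_image c a -> exists k, is_order c k /\ (k %| a)%N.
Proof.
move=> a_gt0 ca.
have lapD (f g : zconfig p q) m : laplacian (f - g *+ m) = laplacian f - laplacian g *+ m.
  apply/ffunP => u; rewrite !(ffunE, laplacianE, ffunMnE).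
  under eq_bigr => w _ do rewrite !(ffunE, ffunMnE).
  rewrite sumrB sumrMnl -[_ *+ m]mulr_natr -[_ *+ m in RHS]mulr_natr.
  by rewrite -[X in _ - (_ - X)]mulr_natr; ring.
have [k k_ord] : exists k, is_order c k.
  elim/ltn_ind: a a_gt0 ca => a IHa a_gt0 ca.
  (* Excluded middle drives the descent to a least multiple, since [multiple_in_image] is not
     boolean. *)
  have [[j [j_lt [j_gt0 cj]]]|no_j] :=
    classic (exists j, (j < a)%N /\ (0 < j)%N /\ multiple_in_image c j).
    exact: IHa cj.
  exists a; split=> // j j_gt0 cj; rewrite leqNgt; apply/negP=> j_lt.
  by apply: no_j; exists j.
have [k_gt0 ck k_min] := k_ord.
exists k; split=> //; rewrite /dvdn -leqn0 leqNgt; apply/negP => r_gt0.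
have := ltn_pmod a k_gt0; rewrite ltnNge => /negP; apply; apply: k_min => //.
have [[f fE] [g gE]] := (ca, ck); exists (f - g *+ (a %/ k)).
by rewrite lapD fE gE -mulrnA {1}(divn_eq a k) mulrnDr mulnC addrC addKr.
Qed.

(** * The sign of a matching *)

Section PairProducts.

Variable N : nat.
Implicit Types (f : 'I_N -> 'I_N -> int).

Lemma prod_pairs_order f (key : 'I_N -> nat) :
    (forall i j, f i j = f j i) -> injective key ->
  \prod_(i : 'I_N) \prod_(j : 'I_N | (i < j)%N) f i j
    = \prod_(j : 'I_N) \prod_(i : 'I_N | (key i < key j)%N) f i j.
Proof.
move=> fC key_inj.
have key_lt i j : i != j -> ((key i < key j) = ~~ (key j < key i))%N.
  by move=> ij; rewrite -leqNgt ltn_neqAle (inj_eq key_inj) ij.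
have ord_lt (i j : 'I_N) : i != j -> ((i < j) = ~~ (j < i))%N.
  by move=> ij; rewrite -leqNgt ltn_neqAle ij.
(* [S] collects the pairs on which two orders agree, [S'] those on which they disagree; symmetry of
   [f] matters only for [S']. *)
pose S (p q : 'I_N -> nat) :=
  \prod_(i : 'I_N) \prod_(j : 'I_N | ((p i < p j) && (q i < q j))%N) f i j.
pose S' (p q : 'I_N -> nat) :=
  \prod_(i : 'I_N) \prod_(j : 'I_N | ((p i < p j) && (q j < q i))%N) f i j.
have splitE (p q : 'I_N -> nat) : injective p -> injective q ->
    \prod_(i : 'I_N) \prod_(j : 'I_N | (p i < p j)%N) f i j = S p q * S' p q.
  move=> p_inj q_inj; rewrite -big_split; apply: eq_bigr => i _.
  rewrite (bigID (fun j => (q i < q j)%N)) /=; congr (_ * _).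
  apply: eq_bigl => j; case: (eqVneq i j) => [->|ij]; first by rewrite !ltnn.
  by rewrite -leqNgt [(q j < q i)%N]ltn_neqAle (inj_eq q_inj) eq_sym ij.
rewrite [RHS](exchange_big_dep xpredT) //=.
rewrite (splitE (@nat_of_ord N) key) //; last exact: val_inj.
rewrite (splitE key (@nat_of_ord N)) //; last exact: val_inj.
congr (_ * _).
  by apply: eq_bigr => i _; apply: eq_bigl => j; rewrite andbC.
rewrite /S' (exchange_big_dep xpredT) //=; apply: eq_bigr => i _.
by apply: eq_big => j; [rewrite andbC | rewrite fC].
Qed.

Lemma prod_pairs_off_diag (g : 'I_N -> 'I_N -> int) :
  (\prod_(i : 'I_N) \prod_(j : 'I_N | (i < j)%N) (g i j * g j i)) * \prod_i g i i
    = \prod_i \prod_j g i j.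
Proof.
under [X in X * _]eq_bigr => i _ do rewrite big_split /=.
rewrite big_split /= [X in _ * X * _](exchange_big_dep xpredT) //= -!big_split /=.
apply: eq_bigr => i _; rewrite [RHS](bigD1 i) //= mulrC; congr (_ * _).
rewrite [RHS](bigID (fun j : 'I_N => (i < j)%N)) /=; congr (_ * _).
  by apply: eq_bigl => j; rewrite -val_eqE /=; lia.
by apply: eq_bigl => j; rewrite -val_eqE /=; lia.
Qed.

(** The product of differences is a Vandermonde determinant whose columns [s] permutes. *)
Lemma sg_perm_Vandermonde (y : 'I_N -> int) (s : 'S_N) :
  \prod_(i : 'I_N) \prod_(j : 'I_N | (i < j)%N) Num.sg (y (s j) - y (s i))
    = (-1) ^+ s * \prod_(i : 'I_N) \prod_(j : 'I_N | (i < j)%N) Num.sg (y j - y i).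
Proof.
have sg_det (z : 'I_N -> int) :
    Num.sg (\det (Vandermonde N (\row_i z i)))
      = \prod_(i : 'I_N) \prod_(j : 'I_N | (i < j)%N) Num.sg (z j - z i).
  rewrite det_Vandermonde.
  rewrite (big_morph _ (@sgrM _) (@sgr1 _)); apply: eq_bigr => i _.
  rewrite (big_morph _ (@sgrM _) (@sgr1 _)); apply: eq_bigr => j _.
  by rewrite !mxE.
rewrite -(sg_det y) -(sg_det (fun i => y (s i))).
have -> : Vandermonde N (\row_i y (s i)) = col_perm s (Vandermonde N (\row_i y i)).
  by apply/matrixP=> i j; rewrite !mxE.
by rewrite col_permE det_mulmx det_perm odd_permV sgrM mulrC sgrX sgrN1.
Qed.

End PairProducts.

(** * Matchings between two sets of points that together fill an initial segment of the integers *)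

Section MatchingSign.

Variables (N L : nat) (x y : 'I_N -> nat).
Hypotheses (x_inj : injective x) (y_inj : injective y).
Hypothesis xy_neq : forall i j, x i != y j.
Hypothesis x_rank : forall k, (\sum_i ((x i < x k) + (y i < x k)) = x k)%N.
Hypothesis y_rank : forall k, (\sum_i ((x i < y k) + (y i < y k)) = y k)%N.

(** The first factor orients the edge. The second is the parity of its crossings with edges started
    earlier: even for a short edge, that of its own start for a long one, whatever the matching. *)
Definition edge_sign (i j : 'I_N) : int :=
  Num.sg ((x i)%:Z - (y j)%:Z) *
  (if (`|x i - y j|%N == 1%N) then 1 else (-1) ^+ minn (x i) (y j)).

Lemma sgz_nat_sub (a b : nat) :
  a != b -> Num.sg (a%:Z - b%:Z) = (-1) ^+ (a < b)%N :> int.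
Proof.
case: (ltngtP a b) => // ab _.
  by rewrite ltr0_sg // subr_lt0 ltz_nat.
by rewrite gtr0_sg // subr_gt0 ltz_nat.
Qed.

Lemma sqr_sgz_nat_sub (a b : nat) :
  a != b -> Num.sg (a%:Z - b%:Z) * Num.sg (a%:Z - b%:Z) = 1 :> int.
Proof. by move=> ab; rewrite sgz_nat_sub // -expr2 sqrr_sign. Qed.

Lemma sqr1_prod (I : finType) (P : pred I) (F : I -> int) :
  (forall i, P i -> F i * F i = 1) ->
  (\prod_(i | P i) F i) * (\prod_(i | P i) F i) = 1.
Proof. by move=> F1; rewrite -big_split big1. Qed.

Section OneMatching.

Variable s : 'S_N.
Hypothesis s_len :
  forall i, `|x i - y (s i)|%N = 1%N \/ `|x i - y (s i)|%N = L.

Let z i := y (s i).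
Let St i := minn (x i) (z i).
Let En i := maxn (x i) (z i).

Let xz_neq i j : x i != z j. Proof. exact: xy_neq. Qed.

Let x_neq i j : i != j -> x i != x j.
Proof. by rewrite (inj_eq x_inj). Qed.

Let z_neq i j : i != j -> z i != z j.
Proof. by rewrite (inj_eq y_inj) (inj_eq perm_inj). Qed.

Let St_inj : injective St.
Proof.
move=> i j; rewrite /St => /eqP St_ij; apply/eqP; apply: contraTT St_ij => ij.
have := x_neq ij; have := z_neq ij.
have := xz_neq i j; have := xz_neq j i; lia.
Qed.

(** For distinct edges this is -1 exactly when their intervals interleave: nested or disjoint
    intervals give an even number of negative factors. *)
Let crossing i j : int :=
  Num.sg ((x j)%:Z - (x i)%:Z) * Num.sg ((z j)%:Z - (z i)%:Z)
  * (Num.sg ((x j)%:Z - (z i)%:Z) * Num.sg ((z j)%:Z - (x i)%:Z)).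

Let crossingC i j : crossing i j = crossing j i.
Proof.
have sgC (a b : int) : Num.sg (a - b) = - Num.sg (b - a) by rewrite -sgrN opprB.
rewrite /crossing (sgC (x j) (x i)) (sgC (z j) (z i)).
by rewrite (sgC (x j) (z i)) (sgC (z j) (x i)); ring.
Qed.

(* Both edge lengths being 1 or L, an edge of length L crosses exactly the
   edges started before it that are still open at its own start. *)
Let crossingE i j : (St i < St j)%N ->
  crossing i j = (-1) ^+ ((`|x j - z j|%N != 1%N) && (St j < En i)%N).
Proof.
move=> St_ij; have ij : i != j by apply: contraTneq St_ij => ->; rewrite ltnn.
have ji : j != i by rewrite eq_sym.
have := x_neq ji; have := z_neq ji.
have := xz_neq i j; have := xz_neq j i; rewrite [x i == z j]eq_sym => zx xz nz nx.
rewrite /crossing !sgz_nat_sub // -!signr_addb; congr (_ ^+ _).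
have := s_len i; have := s_len j; move: St_ij zx xz nz nx; rewrite /St /En -!/(z _).
move: (x i) (x j) (z i) (z j) => xi xj zi zj; lia.
Qed.

(* Among the St j positions before the start of edge j, those not matched with
   each other belong to the edges open at St j. *)
Let open_edges j :
  (-1) ^+ (\sum_(i | (St i < St j)%N) (St j < En i))%N = (-1) ^+ St j :> int.
Proof.
have rank : (\sum_i ((x i < St j) + (z i < St j)) = St j)%N.
  have -> : (\sum_i ((x i < St j) + (z i < St j))
      = \sum_i ((x i < St j) + (y i < St j)))%N.
    rewrite !big_split /=; congr (_ + _)%N.
    by rewrite [RHS](reindex_perm s).
  by rewrite /St /minn; case: (x j < z j)%N; [exact: x_rank | exact: y_rank].
rewrite -signr_odd -[RHS]signr_odd -[in RHS]rank; congr (_ ^+ _); congr nat_of_bool.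
have -> : (\sum_i ((x i < St j) + (z i < St j)) =
    \sum_(i | (St i < St j)%N) (St j < En i) + (\sum_i (En i < St j)).*2)%N.
  rewrite -muln2 big_distrl /= [X in (X + _)%N]big_mkcond -big_split /=.
  apply: eq_bigr => i _; case: (eqVneq i j) => [->|ij]; rewrite /St /En.
    by have := xz_neq j j; case: ifP; lia.
  have := x_neq ij; have := z_neq ij; have := xz_neq i j; have := xz_neq j i.
  by case: ifP; lia.
by rewrite oddD odd_double addbF.
Qed.

(** The crossing signs are multiplied in two ways: edge by edge in the order of starts, which gives
    the second factors of [edge_sign], and as products of differences, which give the sign of [s]
    times terms independent of [s]. *)
Lemma prod_edge_sign :
  (\prod_(i : 'I_N) \prod_(j : 'I_N | (i < j)%N) Num.sg ((x j)%:Z - (x i)%:Z))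
  * (\prod_(i : 'I_N) \prod_(j : 'I_N | (i < j)%N) Num.sg ((y j)%:Z - (y i)%:Z))
  * (\prod_(i : 'I_N) \prod_(j : 'I_N | (i < j)%N) -1)
  * (\prod_(i : 'I_N) \prod_(j : 'I_N) Num.sg ((x i)%:Z - (y j)%:Z)) * (-1) ^+ s
  = \prod_i edge_sign i (s i).
Proof.
pose g i j : int := Num.sg ((x i)%:Z - (z j)%:Z).
have diagE : \prod_(i : 'I_N) \prod_(j : 'I_N) Num.sg ((x i)%:Z - (y j)%:Z)
    = \prod_i \prod_j g i j.
  by apply: eq_bigr => i _; rewrite (reindex_perm s).
have crossE : \prod_(i : 'I_N) \prod_(j : 'I_N | (i < j)%N) crossing i j
    = \prod_j (if `|x j - z j|%N == 1%N then 1 else (-1) ^+ St j).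
  rewrite (prod_pairs_order crossingC St_inj); apply: eq_bigr => j _.
  rewrite (eq_bigr _ (fun i => @crossingE i j)).
  case: eqP => _; first by rewrite big1.
  by rewrite -open_edges /= (big_morph _ (exprD _) (expr0 _)).
rewrite /edge_sign big_split /= -crossE diagE -prod_pairs_off_diag.
have -> : \prod_(i : 'I_N) \prod_(j : 'I_N | (i < j)%N) crossing i j
  = (\prod_(i : 'I_N) \prod_(j : 'I_N | (i < j)%N) Num.sg ((x j)%:Z - (x i)%:Z))
  * (\prod_(i : 'I_N) \prod_(j : 'I_N | (i < j)%N) Num.sg ((z j)%:Z - (z i)%:Z))
  * ((\prod_(i : 'I_N) \prod_(j : 'I_N | (i < j)%N) -1)
    * (\prod_(i : 'I_N) \prod_(j : 'I_N | (i < j)%N) (g i j * g j i))).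
  rewrite -!big_split; apply: eq_bigr => i _; rewrite -!big_split.
  apply: eq_bigr => j _ /=.
  have -> : g i j = - Num.sg ((z j)%:Z - (x i)%:Z) by rewrite -sgrN opprB.
  by rewrite /crossing /g; ring.
have ringE (a b c d e f : int) :
  a * b * c * (d * e) * f = e * (a * (f * b) * (c * d)) by ring.
by rewrite (sg_perm_Vandermonde (fun i => (y i)%:Z) s) ringE.
Qed.

End OneMatching.

Lemma matching_sign : exists2 eps : int, eps * eps = 1 & forall s : 'S_N,
    (forall i, `|x i - y (s i)|%N = 1%N \/ `|x i - y (s i)|%N = L) ->
  (-1) ^+ s = eps * \prod_i edge_sign i (s i).
Proof.
have [eps [epsE eps1]] : exists eps : int, (forall s : 'S_N,
    (forall i, `|x i - y (s i)|%N = 1%N \/ `|x i - y (s i)|%N = L) ->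
    eps * (-1) ^+ s = \prod_i edge_sign i (s i)) /\ eps * eps = 1.
  (* Unification sets [eps] to the product of the factors independent of [s]. *)
  eexists; split; first exact: prod_edge_sign.
  have sq1M (a b : int) : a * a = 1 -> b * b = 1 -> (a * b) * (a * b) = 1.
    by move=> a1 b1; rewrite mulrACA a1 b1.
  have inj_lt (t : 'I_N -> nat) (i j : 'I_N) : injective t -> (i < j)%N -> t j != t i.
    by move=> t_inj; rewrite (inj_eq t_inj) -val_eqE /=; case: ltngtP.
  apply/sq1M; [apply/sq1M; [apply/sq1M|]|];
    apply: sqr1_prod => i _; apply: sqr1_prod => j ij //.
  - by apply: sqr_sgz_nat_sub; apply: inj_lt.
  - by apply: sqr_sgz_nat_sub; apply: inj_lt.
  - exact: sqr_sgz_nat_sub.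
exists eps => // s s_len.
by rewrite -(epsE _ s_len) mulrA eps1 mul1r.
Qed.

End MatchingSign.

(** * Domino tilings and the Kasteleyn determinant *)

Section TilingsAsPermutations.

Variables (p q N : nat) (b w : 'I_N -> cell p q).
Hypotheses (b_inj : injective b) (w_inj : injective w).
Hypothesis bw_neq : forall i j, b i != w j.
Hypothesis bw_cover : forall u, (exists i, u = b i) \/ (exists i, u = w i).
Hypothesis adj_bb : forall i j, adj (b i) (b j) = false.
Hypothesis adj_ww : forall i j, adj (w i) (w j) = false.

Definition matching_tiling (s : 'S_N) : {set {set cell p q}} :=
  [set [set b i; w (s i)] | i in 'I_N].

Definition matchings : {set 'S_N} := [set s : 'S_N | [forall i, adj (b i) (w (s i))]].

Lemma dominoP (B : {set cell p q}) :
  reflect (exists i j, adj (b i) (w j) /\ B = [set b i; w j]) (domino B).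
Proof.
apply: (iffP existsP) => [[u /existsP[v /andP[uv /eqP->]]]|[i [j [ij ->]]]].
  case: (bw_cover u) uv => -[i ->]; case: (bw_cover v) => -[j ->].
  - by rewrite adj_bb.
  - by exists i, j.
  - by rewrite adjC setUC; exists j, i.
  - by rewrite adj_ww.
by exists (b i); apply/existsP; exists (w j); rewrite ij eqxx.
Qed.

Lemma b_in_domino i i' j : (b i \in [set b i'; w j]) = (i == i').
Proof. by rewrite !inE (inj_eq b_inj) (negPf (bw_neq _ _)) orbF. Qed.

Lemma w_in_domino j i j' : (w j \in [set b i; w j']) = (j == j').
Proof. by rewrite !inE eq_sym (negPf (bw_neq _ _)) (inj_eq w_inj). Qed.

Lemma matching_tiling_inj : injective matching_tiling.
Proof.
move=> s t st; apply/permP => i.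
have : [set b i; w (s i)] \in matching_tiling t by rewrite -st; apply: imset_f.
case/imsetP => j _ e.
have /eqP ij : i == j by rewrite -(b_in_domino i j (t j)) -e b_in_domino.
have := w_in_domino (s i) j (t j); rewrite -e w_in_domino eqxx => /esym/eqP ->.
by rewrite ij.
Qed.

(** Conversely to [matching_tiling], the block of each black cell contains one white cell;
    disjointness of blocks makes this map injective, hence a permutation. *)
Lemma domino_tilingsE : domino_tilings p q = matching_tiling @: matchings.
Proof.
apply/setP => P; rewrite inE; apply/andP/imsetP; last first.
  case=> s; rewrite inE => /forallP s_adj ->; split; last first.
    apply/forall_inP => B /imsetP[i _ ->]; apply/dominoP.
    by exists i, (s i).
  apply/and3P; split.
  - rewrite eqEsubset subsetT; apply/subsetP => u _; apply/bigcupP.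
    case: (bw_cover u) => -[i ->].
      by exists [set b i; w (s i)]; [apply: imset_f | rewrite b_in_domino].
    exists [set b (s^-1 i)%g; w (s (s^-1 i)%g)]; first exact: imset_f.
    by rewrite w_in_domino permKV.
  - apply/trivIsetP => A B /imsetP[i _ ->] /imsetP[j _ ->] ne.
    have ij : i != j by apply: contraNneq ne => ->.
    rewrite disjoint_subset; apply/subsetP => u; rewrite [u \in _]inE !inE.
    case/orP => /eqP->; rewrite negb_or.
      by rewrite (inj_eq b_inj) ij bw_neq.
    by rewrite eq_sym bw_neq (inj_eq w_inj) (inj_eq perm_inj).
  - apply/imsetP => -[i _] /setP/(_ (b i)).
    by rewrite b_in_domino eqxx inE.
case=> /and3P[/eqP covP trivP P0] /forall_inP domP.
have block u : pblock P u \in P /\ u \in pblock P u.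
  by rewrite mem_pblock covP inE pblock_mem // covP inE.
have /fin_all_exists[f fP] i :
    exists j, adj (b i) (w j) /\ pblock P (b i) = [set b i; w j].
  have [/domP/dominoP[i' [j [ij' blockE]]] bi] := block (b i).
  move: bi; rewrite blockE b_in_domino => /eqP ->.
  by exists j.
have f_inj : injective f.
  move=> i i' ff.
  have [bi _] := block (b i); have [bi' _] := block (b i').
  have e : pblock P (b i) = pblock P (b i').
    transitivity (pblock P (w (f i))).
      by apply/esym/def_pblock => //; rewrite (fP i).2 w_in_domino.
    by apply: def_pblock => //; rewrite (fP i').2 ff w_in_domino.
  have [_] := block (b i).
  rewrite e (fP i').2 b_in_domino; exact: eqP.
exists (perm f_inj).
  by rewrite inE; apply/forallP => i; rewrite permE; have [] := fP i.
apply/setP => B; apply/idP/imsetP => [BP|[i _ ->]].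
  have /dominoP[i [j [_ Bij]]] := domP _ BP.
  exists i => //; rewrite permE -(fP i).2; apply/esym/def_pblock => //.
  by rewrite Bij b_in_domino.
by rewrite permE -(fP i).2; have [] := block (b i).
Qed.

Lemma card_domino_tilings : #|domino_tilings p q| = #|matchings|.
Proof. by rewrite domino_tilingsE card_imset //; apply: matching_tiling_inj. Qed.

End TilingsAsPermutations.

(** * Checkerboard colouring and row-major order of the even square *)

Section EvenSquare.

Variable n : nat.
Local Notation N := (n * n + n * n)%N.

Lemma dbl_subproof (e : bool) (k : 'I_n) : (e + 2 * k < 2 * n)%N.
Proof. by have := ltn_ord k; case: e; lia. Qed.

Definition dbl (e : bool) (k : 'I_n) : 'I_(2 * n) := Ordinal (dbl_subproof e k).

(** The numbering follows the blocks of [double_mx]: parities of the coordinates select the block,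
    their halves the entry in it. *)
Definition black (i : 'I_N) : cell (2 * n) (2 * n) :=
  match split i with
  | inl k => (dbl false (mxtens_unindex k).1, dbl false (mxtens_unindex k).2)
  | inr k => (dbl true (mxtens_unindex k).1, dbl true (mxtens_unindex k).2)
  end.

Definition white (i : 'I_N) : cell (2 * n) (2 * n) :=
  match split i with
  | inl k => (dbl false (mxtens_unindex k).1, dbl true (mxtens_unindex k).2)
  | inr k => (dbl true (mxtens_unindex k).1, dbl false (mxtens_unindex k).2)
  end.

Variant block_index_spec : 'I_N -> Type :=
  | BlockIndexL k l : block_index_spec (lshift (n * n) (mxtens_index (k, l)))
  | BlockIndexR k l : block_index_spec (rshift (n * n) (mxtens_index (k, l))).

Lemma blockP i : block_index_spec i.
Proof.
by rewrite -[i]splitK; case: (split i) => k /=; case: (mxtens_indexP k) => *; constructor.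
Qed.

Lemma blackL k l : black (lshift _ (mxtens_index (k, l))) = (dbl false k, dbl false l).
Proof. by rewrite /black (unsplitK (inl _)) mxtens_indexK. Qed.
Lemma blackR k l : black (rshift _ (mxtens_index (k, l))) = (dbl true k, dbl true l).
Proof. by rewrite /black (unsplitK (inr _)) mxtens_indexK. Qed.
Lemma whiteL k l : white (lshift _ (mxtens_index (k, l))) = (dbl false k, dbl true l).
Proof. by rewrite /white (unsplitK (inl _)) mxtens_indexK. Qed.
Lemma whiteR k l : white (rshift _ (mxtens_index (k, l))) = (dbl true k, dbl false l).
Proof. by rewrite /white (unsplitK (inr _)) mxtens_indexK. Qed.
Definition colorE := (blackL, blackR, whiteL, whiteR).

Lemma dbl_eq e e' k k' : (dbl e k == dbl e' k') = (e == e') && (k == k').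
Proof. by rewrite -!val_eqE /=; case: e; case: e'; rewrite /=; lia. Qed.

Lemma dblP (r : 'I_(2 * n)) : exists e k, r = dbl e k.
Proof.
have r2 : (r./2 < n)%N by have := ltn_ord r; lia.
exists (odd r), (Ordinal r2); apply: val_inj => /=; lia.
Qed.

Lemma black_inj : injective black.
Proof.
by move=> i j; case: (blockP i) => k l; case: (blockP j) => k' l';
  rewrite !colorE => /eqP; rewrite xpair_eqE !dbl_eq //= => /andP[/eqP-> /eqP->].
Qed.

Lemma white_inj : injective white.
Proof.
by move=> i j; case: (blockP i) => k l; case: (blockP j) => k' l';
  rewrite !colorE => /eqP; rewrite xpair_eqE !dbl_eq //= => /andP[/eqP-> /eqP->].
Qed.

Lemma black_white_neq i j : black i != white j.
Proof.
by case: (blockP i) => k l; case: (blockP j) => k' l';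
  rewrite !colorE xpair_eqE !dbl_eq //= andbF.
Qed.

Lemma black_white_cover u : (exists i, u = black i) \/ (exists i, u = white i).
Proof.
case: u => r c; have [e [k ->]] := dblP r; have [e' [l ->]] := dblP c.
case: e; case: e'.
- by left; exists (rshift _ (mxtens_index (k, l))); rewrite colorE.
- by right; exists (rshift _ (mxtens_index (k, l))); rewrite colorE.
- by right; exists (lshift _ (mxtens_index (k, l))); rewrite colorE.
- by left; exists (lshift _ (mxtens_index (k, l))); rewrite colorE.
Qed.

Lemma adj_black i j : adj (black i) (black j) = false.
Proof.
by case: (blockP i) => k l; case: (blockP j) => k' l'; rewrite !colorE /adj /=; lia.
Qed.

Lemma adj_white i j : adj (white i) (white j) = false.
Proof.
by case: (blockP i) => k l; case: (blockP j) => k' l'; rewrite !colorE /adj /=; lia.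
Qed.

Definition pos (u : cell (2 * n) (2 * n)) : nat := mxtens_index u.

Lemma pos_inj : injective pos.
Proof. by move=> u v /val_inj /(can_inj (@mxtens_indexK _ _)). Qed.

Lemma posE u : pos u = (u.1 * (2 * n) + u.2)%N.
Proof. by []. Qed.

Lemma sum_cells (F : cell (2 * n) (2 * n) -> nat) :
  (\sum_u F u = \sum_i (F (black i) + F (white i)))%N.
Proof.
pose g (x : 'I_N + 'I_N) := match x with inl i => black i | inr i => white i end.
have g_inj : injective g.
  case=> i [] j /= e; first by rewrite (black_inj e).
  - by have := black_white_neq i j; rewrite e eqxx.
  - by have := black_white_neq j i; rewrite e eqxx.
  - by rewrite (white_inj e).
have g_bij : bijective g.
  apply: inj_card_bij => //.
  by rewrite card_sum !card_ord card_prod !card_ord; nia.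
rewrite (reindex g) /=; last exact: onW_bij.
by rewrite big_sumType big_split.
Qed.

Lemma pos_rank u : (\sum_i ((pos (black i) < pos u) + (pos (white i) < pos u)) = pos u)%N.
Proof.
rewrite -(sum_cells (fun v => pos v < pos u)%N).
rewrite /pos; move: (mxtens_index u) => k.
rewrite (reindex (@mxtens_unindex _ _)); last first.
  by exists (@mxtens_index _ _) => v _; rewrite (mxtens_indexK, mxtens_unindexK).
under eq_bigr => v _ do rewrite mxtens_unindexK.
transitivity (\sum_(v < 2 * n * (2 * n) | v < k) 1)%N.
  by rewrite [RHS]big_mkcond; apply: eq_bigr => v _; case: ifP.
rewrite -(big_ord_widen _ (fun=> 1%N)); first by rewrite sum1_card card_ord.
exact: ltnW.
Qed.

End EvenSquare.

(** * Edge signs for the four directions of a domino *)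

Lemma edge_sign_sqr N (x y : 'I_N -> nat) i j :
  x i != y j -> edge_sign x y i j * edge_sign x y i j = 1.
Proof.
move=> xy; rewrite /edge_sign mulrACA sqr_sgz_nat_sub // mul1r.
by case: ifP => _; rewrite ?mulr1 // -expr2 sqrr_sign.
Qed.

Lemma edge_sign_right N (x y : 'I_N -> nat) i j :
  y j = (x i).+1 -> edge_sign x y i j = -1.
Proof.
move=> yx; rewrite /edge_sign yx ifT; last by lia.
by rewrite sgz_nat_sub ?ltnSn ?mulr1 //; lia.
Qed.

Lemma edge_sign_left N (x y : 'I_N -> nat) i j :
  x i = (y j).+1 -> edge_sign x y i j = 1.
Proof.
move=> xy; rewrite /edge_sign xy ifT; last by lia.
by rewrite sgz_nat_sub ?ltnNge ?leqnSn ?mulr1 //; lia.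
Qed.

Lemma edge_sign_down N (x y : 'I_N -> nat) i j L : (1 < L)%N ->
  y j = (x i + L)%N -> edge_sign x y i j = - (-1) ^+ odd (x i).
Proof.
move=> L1 yx; rewrite /edge_sign yx ifF; last by lia.
rewrite sgz_nat_sub; last by lia.
rewrite (_ : (x i < x i + L)%N) ?mulN1r; last by lia.
by rewrite (_ : minn _ _ = x i) ?signr_odd //; lia.
Qed.

Lemma edge_sign_up N (x y : 'I_N -> nat) i j L : (1 < L)%N ->
  x i = (y j + L)%N -> edge_sign x y i j = (-1) ^+ odd (y j).
Proof.
move=> L1 xy; rewrite /edge_sign xy ifF; last by lia.
rewrite sgz_nat_sub; last by lia.
rewrite (_ : (y j + L < y j)%N = false) ?mul1r; last by lia.
by rewrite (_ : minn _ _ = y j) ?signr_odd //; lia.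
Qed.

Section Kasteleyn.

Variable n : nat.
Local Notation N := (n * n + n * n)%N.

Lemma adj_dist (u v : cell (2 * n) (2 * n)) : adj u v ->
  `|pos u - pos v|%N = 1%N \/ `|pos u - pos v|%N = (2 * n)%N.
Proof.
rewrite !posE /adj; move: (nat_of_ord u.1) (nat_of_ord v.1) => r r'.
move: (nat_of_ord u.2) (nat_of_ord v.2) => c c' /eqP uv.
have [[-> cc']|[[->| ->] ->]] : (r = r' /\ `|c - c'| = 1)%N \/
    ((r = r'.+1 \/ r' = r.+1) /\ c = c') by lia.
- by left; lia.
- by right; rewrite mulSn; lia.
- by right; rewrite mulSn; lia.
Qed.

Definition kast_sign (i : 'I_N) : int := if split i is inl _ then -1 else 1.

(* The Kasteleyn signs cancel the crossing signs up to a factor -1 for each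
   domino avoiding the (odd, odd) cells, whose number is fixed. *)
Lemma double_bidiagE (i j : 'I_N) :
  double_mx (bidiag n) i j
    = if adj (black i) (white j)
      then kast_sign i
        * edge_sign (fun i => pos (black i)) (fun i => pos (white i)) i j
      else 0.
Proof.
have idxL : split (lshift (n * n) _) = inl _ := unsplitK (inl _).
have idxR : split (rshift (n * n) _) = inr _ := unsplitK (inr _).
have n2 (k : 'I_n) : (1 < 2 * n)%N by have := ltn_ord k; lia.
rewrite /double_mx /kast_sign.
case: (blockP i) => k l; case: (blockP j) => k' l';
  rewrite ?idxL ?idxR ?(block_mxEul, block_mxEur, block_mxEdl, block_mxEdr).
- rewrite tensmxE !mxE !colorE.
  have -> : adj (dbl false k, dbl false l) (dbl false k', dbl true l')
      = (k == k') && ((l == l') || (l == l'.+1 :> nat)).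
    by rewrite -!val_eqE /adj /=; lia.
  case: (eqVneq k k') => [<-|_]; last by rewrite mul0r.
  rewrite mul1r; case: (eqVneq l l') => [<-|ll'].
    by rewrite ltn_eqF // edge_sign_right ?colorE // !posE /=; lia.
  case: eqP => [lE|_]; last by rewrite subrr.
  by rewrite edge_sign_left ?colorE // !posE /=; lia.
- rewrite tensmxE !mxE !colorE.
  have -> : adj (dbl false k, dbl false l) (dbl true k', dbl false l')
      = (l == l') && ((k == k') || (k == k'.+1 :> nat)).
    by rewrite -!val_eqE /adj /=; lia.
  case: (eqVneq l l') => [<-|_]; last by rewrite mulr0.
  rewrite mulr1; case: (eqVneq k k') => [<-|kk'].
    (* Rows have even length, so the parity of a position is that of its column. *)
    rewrite ltn_eqF // (edge_sign_down (n2 k)) ?colorE ?posE /=; last by lia.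
    by rewrite oddD !oddM.
  case: eqP => [kE|_]; last by rewrite subrr.
  rewrite (edge_sign_up (n2 k)) ?colorE ?posE /=; last by rewrite kE; lia.
  by rewrite oddD !oddM /= ?andbF.
- rewrite mxE tensmxE !mxE !colorE.
  have -> : adj (dbl true k, dbl true l) (dbl false k', dbl true l')
      = (l == l') && ((k == k') || (k' == k.+1 :> nat)).
    by rewrite -!val_eqE /adj /=; lia.
  case: (eqVneq l l') => [<-|_]; last by rewrite mulr0 oppr0.
  rewrite mulr1 [k' == k]eq_sym; case: (eqVneq k k') => [<-|kk'].
    rewrite ltn_eqF // (edge_sign_up (n2 k)) ?colorE ?posE /=; last by lia.
    by rewrite !(oddD, oddM) /= ?andbF.
  case: eqP => [kE|_]; last by rewrite subrr oppr0.
  rewrite (edge_sign_down (n2 k)) ?colorE ?posE /=; last by rewrite kE; lia.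
  by rewrite !(oddD, oddM) /= ?andbF.
- rewrite tensmxE !mxE !colorE.
  have -> : adj (dbl true k, dbl true l) (dbl true k', dbl false l')
      = (k == k') && ((l == l') || (l' == l.+1 :> nat)).
    by rewrite -!val_eqE /adj /=; lia.
  case: (eqVneq k k') => [<-|_]; last by rewrite mul0r.
  rewrite mul1r [l' == l]eq_sym; case: (eqVneq l l') => [<-|ll'].
    by rewrite ltn_eqF // edge_sign_left ?colorE // !posE /=; lia.
  case: eqP => [lE|_]; last by rewrite subrr.
  by rewrite edge_sign_right ?colorE // !posE /=; lia.
Qed.

(** In the Leibniz expansion, permutations that are not matchings contribute 0 and all others the
    same unit, so nothing cancels. *)
Lemma card_domino_tilings_det :
  `|\det (double_mx (bidiag n))| = #|domino_tilings (2 * n) (2 * n)|%:Z.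
Proof.
rewrite (card_domino_tilings (@black_inj n) (@white_inj n) (@black_white_neq n)
  (@black_white_cover n) (@adj_black n) (@adj_white n)).
have [eps eps1 signE] := @matching_sign N (2 * n)
  (fun i => pos (black i)) (fun i => pos (white i))
  (inj_comp (@pos_inj n) (@black_inj n)) (inj_comp (@pos_inj n) (@white_inj n))
  (fun i j => etrans (congr1 negb (inj_eq (@pos_inj n) _ _)) (black_white_neq i j))
  (fun k => pos_rank _) (fun k => pos_rank _).
have -> : \det (double_mx (bidiag n))
    = \sum_(s in matchings (@black n) (@white n)) eps * \prod_i kast_sign i.
  rewrite [RHS]big_mkcond; apply: eq_bigr => s _; rewrite inE.
  under eq_bigr => i _ do rewrite double_bidiagE.
  case: ifP => [/forallP s_adj|/negbT]; last first.
    rewrite negb_forall => /existsP[i /negPf ni].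
    by rewrite (bigD1 i) //= ni mul0r mulr0.
  rewrite signE => [|i]; last exact: adj_dist.
  rewrite -mulrA; congr (_ * _); rewrite -big_split /=; apply: eq_bigr => i _.
  by rewrite s_adj mulrCA edge_sign_sqr ?mulr1 // (inj_eq (@pos_inj n)) black_white_neq.
rewrite sumr_const normrMn normrM normr_prod.
rewrite [X in _ * X]big1 => [|i _]; last first.
  by rewrite /kast_sign; case: split => _; rewrite ?normrN normr1.
have /eqP := eps1; rewrite -expr2 sqrf_eq1 => /orP[]/eqP->;
  by rewrite ?normrN normr1 mulr1 natz.
Qed.

End Kasteleyn.

(* The order is stated as "exists k, is_order c k /\ ...": such a k is
   necessarily unique, and its existence is part of the claim. *)
Theorem corollary5p6 (n a : nat) (hn : (1 <= n)%N) (ha : odd a)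
    (hcount : #|domino_tilings (2 * n) (2 * n)| = (2 ^ n * a ^ 2)%N) :
  exists k : nat, is_order (all_twos (2 * n) (2 * n)) k /\ (k %| a)%N.
Proof.
apply: is_order_dvdn; first by case: a ha {hcount}.
case: n hn hcount => // n _ hcount.
have detE : `|\det (double_mx (bidiag n.+1))| = (2 ^ n.+1 * a ^ 2)%:R.
  by rewrite card_domino_tilings_det hcount natz.
(* The factor 2 in [2 * a] is absorbed by the two grains on each cell, which leaves the multiple
   [a]. *)
have [Y YE] := sylvester_solvable (det_bidiag n.+1) detE (const_mx 1).
exists (unfold_config Y); apply/ffunP => u.
rewrite laplacian_unfold YE mulrnA ffunMnE !ffunE.
by rewrite !mulmxnE !mxE natz.
Qed.
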